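(* Let $\Gamma$ be a group, $R$ a $\Gamma$-graded ring, $\gamma\in C_\Gamma(\Gamma_R)$, and $\delta\in\mathrm{Der}_\gamma(R)$. If $R$ is gr-right-Noetherian (resp. gr-left-Noetherian), then $R[t;\delta]$ is gr-right-Noetherian (resp. gr-left-Noetherian).
   Context: Rings are associative with identity; $\Gamma$ is a (not necessarily abelian) group with identity $e$. A ring $R$ is $\Gamma$-graded if $R=\bigoplus_{\sigma\in\Gamma}R_\sigma$ with $R_\sigma R_\tau\subseteq R_{\sigma\tau}$ and $1_R\in R_e$; its support is $\Gamma_R=\{\sigma:R_\sigma\neq0\}$, and $C_\Gamma(\Gamma_R)$ is the centralizer of $\Gamma_R$ in $\Gamma$. $\mathrm{Der}_\gamma(R)$ is the set of additive maps $\delta:R\to R$ with $\delta(xy)=\delta(x)y+x\delta(y)$ and $\delta(R_\tau)\subseteq R_{\tau\gamma}$ for all $\tau\in\Gamma_R$. $R[t;\delta]$ is the free left $R$-module on $\{t^k\}_{k\ge0}$ with multiplication determined by $tx=xt+\delta(x)$, graded by $R[t;\delta]_\tau=\bigoplus_{i\ge0}R_{\tau\gamma^{-i}}t^i$. A left or right ideal is graded if it contains the homogeneous components of each of its elements. A graded ring is gr-right-Noetherian (resp. gr-left-Noetherian) if every ascending chain of graded right (resp. left) ideals stabilizes. *)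

(* Defs.v *)
From HB Require Import structures.
From mathcomp Require Import all_boot all_order all_algebra finmap.
From mathcomp Require Import monalg.
Set Implicit Arguments.
Unset Strict Implicit.
Unset Printing Implicit Defensive.

Import GRing.Theory.
Local Open Scope ring_scope.

(* Rings may be zero and need not be commutative: [pzRingType].  Subsets of a
   ring are [Prop]-valued predicates, since gradings and ideals need not be
   decidable. *)

Section Grading.
Variables (Γ : groupType) (R : pzRingType).
Implicit Types (A : Γ -> R -> Prop) (σ τ γ : Γ) (c : {malg R[Γ]}).

(* [{malg R[Γ]}] is only used here as the type of finitely supported functions
   from Γ to R. *)
Definition decomposition A (x : R) c : Prop :=
  (forall σ, A σ c@_σ) /\ x = \sum_(σ <- msupp c) c@_σ.

Record is_grading A : Prop := {
  is_grading0 : forall σ, A σ 0;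
  is_gradingB : forall σ x y, A σ x -> A σ y -> A σ (x - y);
  is_grading_direct : forall x, exists! c, decomposition A x c;
  is_gradingM : forall σ τ x y, A σ x -> A τ y -> A (σ * τ)%g (x * y);
  is_grading1 : A 1%g 1
}.

Record grading := Grading {
  gr_comp :> Γ -> R -> Prop;
  gradingP : is_grading gr_comp
}.

Definition gr_support A σ : Prop := exists2 x, A σ x & x <> 0.

Definition centralizes_support A γ : Prop :=
  forall σ, gr_support A σ -> commute γ σ.

Definition left_ideal (I : R -> Prop) : Prop :=
  [/\ I 0, forall x y, I x -> I y -> I (x - y)
         & forall a x, I x -> I (a * x)].

Definition right_ideal (I : R -> Prop) : Prop :=
  [/\ I 0, forall x y, I x -> I y -> I (x - y)
         & forall x a, I x -> I (x * a)].

Definition graded_subset A (I : R -> Prop) : Prop :=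
  forall x c, I x -> decomposition A x c -> forall σ, I c@_σ.

Definition ascending_chain_condition (P : (R -> Prop) -> Prop) : Prop :=
  forall I : nat -> R -> Prop,
    (forall n, P (I n)) -> (forall n x, I n x -> I n.+1 x) ->
    exists N, forall n, (N <= n)%N -> forall x, I n x <-> I N x.

Definition gr_left_noetherian (A : grading) : Prop :=
  ascending_chain_condition (fun I => left_ideal I /\ graded_subset A I).

Definition gr_right_noetherian (A : grading) : Prop :=
  ascending_chain_condition (fun I => right_ideal I /\ graded_subset A I).

End Grading.

HB.mixin Record isDerivation (R : pzRingType) (d : R -> R) := {
  derM : forall x y, d (x * y) = d x * y + x * d y
}.

#[short(type="derivation")]
HB.structure Definition Derivation (R : pzRingType) :=
  {d of isDerivation R d & GRing.isZmodMorphism R R d}.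

(* Together with the bundled additivity and Leibniz rule, this says that the
   derivation d belongs to Der_γ(R). *)
Definition der_degree (Γ : groupType) (R : pzRingType) (A : Γ -> R -> Prop)
    (γ : Γ) (d : R -> R) : Prop :=
  forall τ, gr_support A τ -> forall x, A τ x -> A (τ * γ)%g (d x).

(* The underlying left R-module of R[t; δ] is free on the powers of t: the
   element p stands for the sum of the p@_k t^k. *)
Definition diffpoly (R : pzRingType) (δ : derivation R) : Type :=
  {malg R[nat]}.

Section DiffPoly.
Variables (R : pzRingType) (δ : derivation R).
Local Notation S := (diffpoly δ).

HB.instance Definition _ := GRing.Zmodule.copy S {malg R[nat]}.

Implicit Types (a b : R) (p q r : S).

Definition dp_coef (k : nat) (p : S) : R := mcoeff k p.
Definition dp_supp (p : S) : {fset nat} := msupp p.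
(* the monomial a t^k *)
Definition dp_mono (k : nat) (a : R) : S := mkmalgU k a.

Definition dp_scale a p : S := \sum_(k <- dp_supp p) dp_mono k (a * dp_coef k p).

(* left multiplication by t: t (a t^k) = a t^(k+1) + δ(a) t^k *)
Definition dp_lmult p : S :=
  \sum_(k <- dp_supp p)
     (dp_mono k.+1 (dp_coef k p) + dp_mono k (δ (dp_coef k p))).

(* (\sum_k a_k t^k) q = \sum_k a_k (t (t ... (t q))) *)
Definition dp_mul p q : S :=
  \sum_(k <- dp_supp p) dp_scale (dp_coef k p) (iter k dp_lmult q).

Definition dp_one : S := dp_mono 0 1.

Lemma dp_coefB k p q : dp_coef k (p - q) = dp_coef k p - dp_coef k q.
Proof. exact: mcoeffB. Qed.

Lemma dp_coef_is_zmod k : zmod_morphism (dp_coef k).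
Proof. exact: dp_coefB. Qed.
HB.instance Definition _ k :=
  GRing.isZmodMorphism.Build S R (dp_coef k) (dp_coef_is_zmod k).

Lemma dp_mono_is_zmod k : zmod_morphism (dp_mono k).
Proof. exact: monalgUB. Qed.
HB.instance Definition _ k :=
  GRing.isZmodMorphism.Build R S (dp_mono k) (dp_mono_is_zmod k).

Lemma dp_coef_mono k l a : dp_coef l (dp_mono k a) = a *+ (k == l).
Proof. exact: mcoeffU. Qed.

Lemma dp_ext p q : (forall k, dp_coef k p = dp_coef k q) -> p = q.
Proof. by move=> h; apply/malgP. Qed.

Lemma dp_coef_out k p : k \notin dp_supp p -> dp_coef k p = 0.
Proof. exact: mcoeff_outdom. Qed.

Lemma dp_sumE p : p = \sum_(k <- dp_supp p) dp_mono k (dp_coef k p).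
Proof. exact: monalgE. Qed.

Lemma dp_supp_mono k a : (dp_supp (dp_mono k a) `<=` [fset k])%fset.
Proof. exact: msuppU_le. Qed.

Lemma dp_coef_scale k a p : dp_coef k (dp_scale a p) = a * dp_coef k p.
Proof.
rewrite {2}[p]dp_sumE /dp_scale !raddf_sum mulr_sumr.
by apply: eq_bigr => l _ /=; rewrite !dp_coef_mono mulrnAr.
Qed.

Lemma dp_coef_lmult k p :
  dp_coef k (dp_lmult p) =
  (if k is l.+1 then dp_coef l p else 0) + δ (dp_coef k p).
Proof.
rewrite /dp_lmult raddf_sum /=.
under eq_bigr => l _ do rewrite raddfD /= !dp_coef_mono.
rewrite big_split /=; congr (_ + _); last first.
  rewrite [in RHS](dp_sumE p) !raddf_sum /=.
  by apply: eq_bigr => l _; rewrite dp_coef_mono raddfMn.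
case: k => [|k]; first by rewrite big1.
rewrite [in RHS](dp_sumE p) raddf_sum /=.
by apply: eq_bigr => l _; rewrite dp_coef_mono eqSS.
Qed.

Lemma dp_scale_is_zmod a : zmod_morphism (dp_scale a).
Proof.
by move=> p q; apply: dp_ext => k; rewrite !(dp_coefB, dp_coef_scale) mulrBr.
Qed.
HB.instance Definition _ a :=
  GRing.isZmodMorphism.Build S S (dp_scale a) (dp_scale_is_zmod a).

Lemma dp_scaleDl a b p : dp_scale (a + b) p = dp_scale a p + dp_scale b p.
Proof.
by apply: dp_ext => k; rewrite raddfD /= !dp_coef_scale mulrDl.
Qed.

Lemma dp_scale0 p : dp_scale 0 p = 0.
Proof. by apply: dp_ext => k; rewrite dp_coef_scale mul0r raddf0. Qed.

Lemma dp_scaleA a b p : dp_scale a (dp_scale b p) = dp_scale (a * b) p.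
Proof. by apply: dp_ext => k; rewrite !dp_coef_scale mulrA. Qed.

Lemma dp_scale1 p : dp_scale 1 p = p.
Proof. by apply: dp_ext => k; rewrite dp_coef_scale mul1r. Qed.

Lemma dp_scaleDr a : {morph dp_scale a : p q / p + q}.
Proof. exact: raddfD. Qed.

Lemma dp_lmult_is_zmod : zmod_morphism dp_lmult.
Proof.
move=> p q; apply: dp_ext => k; rewrite !(dp_coefB, dp_coef_lmult) raddfB /=.
by case: k => [|k]; rewrite ?subr0 ?add0r // dp_coefB opprD addrACA.
Qed.
HB.instance Definition _ :=
  GRing.isZmodMorphism.Build S S dp_lmult dp_lmult_is_zmod.

Lemma dp_lmult_scale a p :
  dp_lmult (dp_scale a p) = dp_scale a (dp_lmult p) + dp_scale (δ a) p.
Proof.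
apply: dp_ext => k; rewrite raddfD /= !(dp_coef_lmult, dp_coef_scale) derM.
rewrite mulrDr -addrA [δ a * _ + _]addrC.
by case: k => [|k]; rewrite ?mulr0 ?dp_coef_scale.
Qed.

Lemma dp_iter_is_zmod k : zmod_morphism (iter k dp_lmult).
Proof. by elim: k => [|k IH] p q //=; rewrite IH raddfB. Qed.
HB.instance Definition _ k :=
  GRing.isZmodMorphism.Build S S (iter k dp_lmult) (dp_iter_is_zmod k).

Lemma dp_mulEw (D : {fset nat}) p q : (dp_supp p `<=` D)%fset ->
  dp_mul p q = \sum_(k <- D) dp_scale (dp_coef k p) (iter k dp_lmult q).
Proof.
move=> sD; apply: big_fset_incl => // k _ /dp_coef_out ->.
exact: dp_scale0.
Qed.

Lemma dp_mulDl : left_distributive dp_mul +%R.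
Proof.
move=> p q r; set D := (dp_supp p `|` dp_supp q)%fset.
rewrite (@dp_mulEw D (p + q)) ?msuppD_le //.
rewrite (@dp_mulEw D p) ?fsubsetUl // (@dp_mulEw D q) ?fsubsetUr //.
rewrite -big_split; apply: eq_bigr => k _.
by rewrite raddfD dp_scaleDl.
Qed.

Lemma dp_mulDr : right_distributive dp_mul +%R.
Proof.
move=> p q r; rewrite /dp_mul -big_split; apply: eq_bigr => k _.
by rewrite !raddfD.
Qed.

Lemma dp_mul0l r : dp_mul 0 r = 0.
Proof. by apply: (addrI (dp_mul 0 r)); rewrite -dp_mulDl !addr0. Qed.

Lemma dp_mul_suml (T : Type) (s : seq T) (F : T -> S) r :
  dp_mul (\sum_(i <- s) F i) r = \sum_(i <- s) dp_mul (F i) r.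
Proof.
exact: (big_morph (dp_mul^~ r) (fun p q => dp_mulDl p q r) (dp_mul0l r)).
Qed.

Lemma dp_mul_mono k a r :
  dp_mul (dp_mono k a) r = dp_scale a (iter k dp_lmult r).
Proof.
rewrite (@dp_mulEw [fset k]%fset) ?dp_supp_mono // big_seq_fset1.
by rewrite dp_coef_mono eqxx.
Qed.

Lemma dp_mul_scale a q r : dp_mul (dp_scale a q) r = dp_scale a (dp_mul q r).
Proof.
rewrite {1}/dp_scale dp_mul_suml [in RHS]/dp_mul raddf_sum.
by apply: eq_bigr => k _ /=; rewrite dp_mul_mono dp_scaleA.
Qed.

Lemma dp_mul_lmult q r : dp_mul (dp_lmult q) r = dp_lmult (dp_mul q r).
Proof.
rewrite {1}/dp_lmult dp_mul_suml [in RHS]/dp_mul raddf_sum.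
apply: eq_bigr => k _ /=; rewrite dp_mulDl !dp_mul_mono.
by rewrite dp_lmult_scale.
Qed.

Lemma dp_mul_iter k q r :
  dp_mul (iter k dp_lmult q) r = iter k dp_lmult (dp_mul q r).
Proof. by elim: k => //= k <-; rewrite dp_mul_lmult. Qed.

Lemma dp_mulA : associative dp_mul.
Proof.
move=> p q r; apply: esym; rewrite {2}/dp_mul dp_mul_suml.
by apply: eq_bigr => k _; rewrite dp_mul_scale dp_mul_iter.
Qed.

Lemma dp_mul1l : left_id dp_one dp_mul.
Proof. by move=> p; rewrite /dp_one dp_mul_mono dp_scale1. Qed.

Lemma der1 : δ 1 = 0.
Proof.
by have := @derM R δ 1 1; rewrite !mulr1 mul1r -{1}[δ 1]addr0 => /addrI.
Qed.

Lemma dp_iter_one k : iter k dp_lmult dp_one = dp_mono k 1.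
Proof.
elim: k => //= k ->; apply: dp_ext => l.
rewrite dp_coef_lmult !dp_coef_mono raddfMn /= der1 mul0rn addr0.
by case: l => //= l; rewrite dp_coef_mono eqSS.
Qed.

Lemma dp_mul1r : right_id dp_one dp_mul.
Proof.
move=> p; rewrite [RHS]dp_sumE; apply: eq_bigr => k _; rewrite dp_iter_one.
apply: dp_ext => l; rewrite dp_coef_scale !dp_coef_mono.
by rewrite mulrnAr mulr1.
Qed.

HB.instance Definition _ := GRing.Zmodule_isPzRing.Build S
  dp_mulA dp_mul1l dp_mul1r dp_mulDl dp_mulDr.

HB.instance Definition _ := GRing.Zmodule_isLmodule.Build R S
  dp_scaleA dp_scale1 dp_scaleDr (fun p a b => dp_scaleDl a b p).

Lemma dp_commutation a :
  dp_mono 1 1 * dp_mono 0 a = dp_mono 0 a * dp_mono 1 1 + dp_mono 0 (δ a).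
Proof.
rewrite ![_ * _]dp_mul_mono /= dp_scale1; apply: dp_ext => k.
rewrite raddfD /= dp_coef_lmult dp_coef_scale !dp_coef_mono raddfMn mulrnAr.
by rewrite mulr1; case: k => [|k] //=; rewrite dp_coef_mono.
Qed.

End DiffPoly.

Section DiffPolyGrading.
Variables (Γ : groupType) (R : pzRingType).

Section Decomposition.
Variables (S : pzRingType) (A : Γ -> S -> Prop).
Hypothesis A0 : forall σ, A σ 0.
Hypothesis AB : forall σ x y, A σ x -> A σ y -> A σ (x - y).

Lemma comp_opp σ x : A σ x -> A σ (- x).
Proof. by move=> hx; rewrite -sub0r; apply: AB. Qed.

Lemma comp_add σ x y : A σ x -> A σ y -> A σ (x + y).
Proof. by move=> hx /comp_opp hy; rewrite -[y]opprK; apply: AB. Qed.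

Lemma comp_sum (I : eqType) (s : seq I) (F : I -> S) σ :
  (forall i, i \in s -> A σ (F i)) -> A σ (\sum_(i <- s) F i).
Proof.
move=> h; rewrite big_seq; elim/big_rec: _ => // i x si hx.
by apply: comp_add => //; apply: h.
Qed.

Lemma decomposition_widen (c : {malg S[Γ]}) (D : {fset Γ}) :
  (msupp c `<=` D)%fset -> \sum_(σ <- msupp c) c@_σ = \sum_(σ <- D) c@_σ.
Proof. by move=> sD; apply: big_fset_incl => // k _ /mcoeff_outdom. Qed.

Lemma decompositionD x y c e : decomposition A x c -> decomposition A y e ->
  decomposition A (x + y) (c + e).
Proof.
move=> [hc ->] [he ->]; split=> [σ|]; first by rewrite mcoeffD; apply: comp_add.
set D := (msupp c `|` msupp e)%fset.
rewrite (@decomposition_widen c D) ?fsubsetUl //.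
rewrite (@decomposition_widen e D) ?fsubsetUr //.
rewrite (@decomposition_widen (c + e) D) ?msuppD_le //.
by rewrite -big_split; apply: eq_bigr => σ _; rewrite mcoeffD.
Qed.

Lemma decomposition0 : decomposition A 0 0.
Proof. by split=> [σ|]; rewrite ?mcoeff0 // msupp0 big_seq_fset0. Qed.

Lemma decomposition_homog σ x : A σ x -> decomposition A x << x *g σ >>.
Proof.
move=> hx; split=> [τ|].
  by rewrite mcoeffU; case: eqP => [<-|_].
rewrite (@decomposition_widen _ [fset σ]%fset) ?msuppU_le //.
by rewrite big_seq_fset1 mcoeffUU.
Qed.

Lemma decomposition_ex_sum (I : eqType) (s : seq I) (F : I -> S) :
  (forall i, i \in s -> exists c, decomposition A (F i) c) ->
  exists c, decomposition A (\sum_(i <- s) F i) c.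
Proof.
move=> h; rewrite big_seq; elim/big_rec: _ => [|i x /h[c hc] [e he]].
  by exists 0; apply: decomposition0.
by exists (c + e); apply: decompositionD.
Qed.

End Decomposition.

Variables (A : grading Γ R) (γ : Γ) (δ : derivation R).

(* R[t; δ]_τ is the sum of the R_(τ γ^-i) t^i *)
Definition diffpoly_comp (τ : Γ) (p : diffpoly δ) : Prop :=
  forall i, A (τ * γ ^- i)%g (dp_coef i p).

Hypothesis γC : centralizes_support A γ.
Hypothesis δdeg : der_degree A γ δ.

Let A0 := is_grading0 (gradingP A).
Let AB := is_gradingB (gradingP A).
Let AM := is_gradingM (gradingP A).
Let AD := comp_add A0 AB.
Local Notation B := diffpoly_comp.

Lemma diffpoly_comp0 σ : B σ 0.
Proof. by move=> i; rewrite raddf0; apply: A0. Qed.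

Lemma diffpoly_compB σ p q : B σ p -> B σ q -> B σ (p - q).
Proof. by move=> hp hq i; rewrite dp_coefB; apply: AB. Qed.

Lemma diffpoly_comp_mono σ k x : A σ x -> B (σ * γ ^+ k)%g (dp_mono δ k x).
Proof.
move=> hx i; rewrite dp_coef_mono; case: eqP => [<-|_]; last exact: A0.
by rewrite mulgK.
Qed.

Lemma diffpoly_decomposition_ex p : exists c, decomposition B p c.
Proof.
rewrite (dp_sumE p).
apply: (decomposition_ex_sum diffpoly_comp0 diffpoly_compB) => k _.
have [c [[hc ->] _]] := is_grading_direct (gradingP A) (dp_coef k p).
rewrite raddf_sum.
apply: (decomposition_ex_sum diffpoly_comp0 diffpoly_compB) => σ _.
exists << dp_mono δ k c@_σ *g (σ * γ ^+ k)%g >>.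
by apply: (decomposition_homog diffpoly_comp0); apply: diffpoly_comp_mono.
Qed.

Lemma diffpoly_decomposition_coef p (c : {malg (diffpoly δ)[Γ]}) i :
  decomposition B p c ->
  exists2 e, decomposition A (dp_coef i p) e &
             forall τ, e@_(τ * γ ^- i)%g = dp_coef i c@_τ.
Proof.
move=> [hc ->].
pose e : {malg R[Γ]} :=
  \sum_(τ <- msupp c) << dp_coef i c@_τ *g (τ * γ ^- i)%g >>.
have eE τ : e@_(τ * γ ^- i)%g = dp_coef i c@_τ.
  rewrite raddf_sum /=.
  under eq_bigr => ρ _ do rewrite mcoeffU (inj_eq (mulIg _)).
  have [hτ|hτ] := boolP (τ \in msupp c).
    rewrite (big_fsetD1 τ) //= eqxx mulr1n big1_fset ?addr0 // => ρ.
    by rewrite in_fsetD1 => /andP[/negbTE-> _].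
  rewrite (mcoeff_outdom hτ) raddf0 big1_fset // => ρ hρ _.
  by case: eqP hτ => // <-; rewrite hρ.
exists e => //.
have eA σ : A σ e@_σ.
  by rewrite -[σ](mulgK (γ ^+ i)%g) eE; apply: hc.
split=> //; rewrite raddf_sum /=.
pose D := [fset (τ * γ ^- i)%g | τ in msupp c]%fset.
rewrite (@decomposition_widen R e D); last first.
  apply/fsubsetP => σ; rewrite -mcoeff_neq0 -[σ](mulgK (γ ^+ i)%g) eE => h.
  apply/imfsetP; exists (σ * γ ^+ i)%g => //=.
  by rewrite -mcoeff_neq0; apply: contra_neq h => ->; rewrite raddf0.
rewrite big_imfset /=; last by move=> x y _ _; apply: mulIg.
by apply: eq_bigr => τ _; rewrite eE.
Qed.

Lemma diffpoly_direct p : exists! c, decomposition B p c.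
Proof.
have [c hc] := diffpoly_decomposition_ex p.
exists c; split=> // c' hc'; apply/malgP => τ; apply: dp_ext => i.
have [e he <-] := diffpoly_decomposition_coef i hc.
have [e' he' <-] := diffpoly_decomposition_coef i hc'.
have [f [_ uf]] := is_grading_direct (gradingP A) (dp_coef i p).
by rewrite -(uf _ he) -(uf _ he').
Qed.

Lemma derA τ x : A τ x -> A (τ * γ)%g (δ x).
Proof.
move=> hx; have [->|/eqP nx] := eqVneq x 0; first by rewrite raddf0; apply: A0.
by apply: δdeg => //; exists x.
Qed.

Lemma diffpoly_comp_lmult τ q : B τ q -> B (τ * γ)%g (dp_lmult q).
Proof.
move=> hq i; rewrite dp_coef_lmult; apply: AD.
  case: i => [|i]; first exact: A0.
  by rewrite expgSr invgM mulgA mulgK; apply: hq.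
have -> : (τ * γ * γ ^- i = τ * γ ^- i * γ)%g.
  by rewrite -!mulgA; congr (_ * _)%g; apply/commuteV/commuteX/commute_refl.
exact: derA.
Qed.

Lemma diffpoly_comp_iter τ k q :
  B τ q -> B (τ * γ ^+ k)%g (iter k (@dp_lmult R δ) q).
Proof.
move=> hq; elim: k => [|k IH] /=; first by rewrite expg0 mulg1.
by rewrite expgSr mulgA; apply: diffpoly_comp_lmult.
Qed.

Lemma diffpoly_comp_scale σ τ a q : A σ a -> B τ q -> B (σ * τ)%g (dp_scale a q).
Proof. by move=> ha hq i; rewrite dp_coef_scale -mulgA; apply: AM. Qed.

Lemma diffpoly_comp_commute τ q : B τ q -> q = 0 \/ commute γ τ.
Proof.
move=> hq; have [/eqP|ncγτ] := boolP (γ * τ == τ * γ)%g; first by right.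
left; apply: dp_ext => i; rewrite raddf0; apply/eqP.
apply: contraNT ncγτ => /eqP qi; have {hq} hqi := hq i.
have : commute γ (τ * γ ^- i)%g by apply: γC; exists (dp_coef i q).
move=> /commuteM/(_ (commuteX i (commute_refl γ))).
by rewrite mulgVK => /eqP.
Qed.

Lemma diffpoly_compM σ τ p q : B σ p -> B τ q -> B (σ * τ)%g (p * q).
Proof.
move=> hp hq; have [->|cγτ] := diffpoly_comp_commute hq.
  by rewrite mulr0; apply: diffpoly_comp0.
rewrite [p * q]/(dp_mul p q) /dp_mul.
apply: (comp_sum diffpoly_comp0 diffpoly_compB) => k _.
have -> : (σ * τ = σ * γ ^- k * (τ * γ ^+ k))%g.
  rewrite -mulgA; congr (_ * _)%g.
  by rewrite (commuteX k (commute_sym cγτ)) mulKg.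
by apply: diffpoly_comp_scale; [apply: hp | apply: diffpoly_comp_iter].
Qed.

Lemma diffpoly_comp1 : B 1%g 1.
Proof.
have := diffpoly_comp_mono 0 (is_grading1 (gradingP A)).
by rewrite expg0 mulg1.
Qed.

Lemma diffpoly_is_grading : is_grading diffpoly_comp.
Proof.
split; [exact: diffpoly_comp0 | exact: diffpoly_compB | exact: diffpoly_direct
       | exact: diffpoly_compM | exact: diffpoly_comp1].
Qed.

Definition diffpoly_grading : grading Γ (diffpoly δ) :=
  Grading diffpoly_is_grading.

End DiffPolyGrading.

(* Main.v *)
Require Import Defs.
From mathcomp Require Import all_boot all_order all_algebra finmap.
From mathcomp Require Import monalg.
Set Implicit Arguments.
Unset Strict Implicit.
Unset Printing Implicit Defensive.

(** This is Hilbert's basis theorem, proved with leading coefficients.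

    For an additive subgroup I of R[t; δ] and k >= 0, let L_k(I), here
    [lead_coefs k I], be the set of the coefficients of t^k in the elements of
    I of degree at most k.  The relation t x = x t + δ(x) changes a product
    only in lower degrees, so the coefficient of t^(k+m) in p q is the product
    of the top coefficients of p and q when deg p <= k and deg q <= m
    ([dp_deg_leM], [dp_coef_lead_mul]).  No automorphism of R twists this
    product, so one argument serves both sides:
    multiplying by constants shows that L_k(I) is a one-sided ideal of R when I
    is one of R[t; δ], and multiplying by t that L_k(I) is contained in
    L_(k+1)(I).  If I is graded, so is L_k(I): the homogeneous components of an
    element of degree at most k have degree at most k, and their coefficients
    of t^k are the components of its own ([graded_lead_coefs]).

    If I is contained in J and L_k(J) in L_k(I) for all k, then I = J, since an
    element of J can be reduced modulo I, one degree at a time, to zero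
    ([lead_coefs_detect]).  So it suffices that an ascending chain
    I_0, I_1, ... has only finitely many distinct L_k(I_n).  The diagonal
    L_n(I_n) is constant from some N on, hence so is L_k(I_n) for k, n >= N;
    each of the finitely many chains L_k(I_n) with k < N stabilizes on its own
    ([acc_transfer]). *)

Import GRing.Theory.
Local Open Scope ring_scope.

(** * Chain conditions and families indexed by degree *)

Lemma chain_le (T : Type) (I : nat -> T -> Prop) :
  (forall n x, I n x -> I n.+1 x) ->
  forall m n, (m <= n)%N -> forall x, I m x -> I n x.
Proof.
move=> incI m n /subnK<-; elim: (n - m)%N => // d IH x Ix.
by rewrite addSn; apply/incI/IH.
Qed.

(** The common index is the maximum of the indices of the single chains;
    the chain condition only gives existence, so it is built by induction. *)
Lemma acc_uniform (R : pzRingType) (P : (R -> Prop) -> Prop)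
    (L : nat -> nat -> R -> Prop) K :
  ascending_chain_condition P ->
  (forall k n, P (L k n)) -> (forall k n x, L k n x -> L k n.+1 x) ->
  exists N, forall k, (k < K)%N ->
    forall n, (N <= n)%N -> forall x, L k n x -> L k N x.
Proof.
move=> accP PL incL; elim: K => [|K [N1 hN1]]; first by exists 0%N.
have [N2 hN2] := accP _ (PL K) (incL K).
exists (maxn N1 N2) => k; rewrite ltnS leq_eqVlt => kK n.
rewrite geq_max => /andP[N1n N2n] x Lx.
case/predU1P: kK => [eK|kK].
  rewrite eK in Lx *; apply: (chain_le (incL K) (leq_maxr N1 N2)).
  exact/(hN2 n).
apply: (chain_le (incL k) (leq_maxl N1 N2)).
exact: (hN1 k kK n).
Qed.

(** Past the index where the diagonal stabilizes, every L_k(I_n) is caught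
    between two equal diagonal terms; below it only finitely many chains are
    left. *)
Lemma acc_transfer (R S : pzRingType) (P : (R -> Prop) -> Prop)
    (Q : (S -> Prop) -> Prop) (L : nat -> (S -> Prop) -> R -> Prop) :
  (forall k I, Q I -> P (L k I)) ->
  (forall k I J, (forall p, I p -> J p) -> forall x, L k I x -> L k J x) ->
  (forall k I, Q I -> forall x, L k I x -> L k.+1 I x) ->
  (forall I J, Q I -> Q J -> (forall p, I p -> J p) ->
    (forall k x, L k J x -> L k I x) -> forall p, J p -> I p) ->
  ascending_chain_condition P -> ascending_chain_condition Q.
Proof.
move=> PL monoL incL detL accP I QI incI.
have incLI k n x : L k (I n) x -> L k (I n.+1) x by apply/monoL/incI.
have PLI k n : P (L k (I n)) by apply: PL.
have LIle k k' n n' : (k <= k')%N -> (n <= n')%N ->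
    forall x, L k (I n) x -> L k' (I n') x.
  move=> kk' nn' x /(chain_le (incLI k) nn').
  exact: (chain_le (fun i => incL i (I n') (QI n')) kk').
have [N1 hN1] := accP (fun n => L n (I n)) (fun n => PLI n n)
  (fun n => LIle n n.+1 n n.+1 (leqnSn n) (leqnSn n)).
have [N2 hN2] := acc_uniform N1 accP PLI incLI.
exists (maxn N1 N2) => n Nn p; split; last exact: (chain_le incI Nn).
apply: detL => // [|k x Lx]; first exact: (chain_le incI Nn).
have [kN1|N1k] := ltnP k N1.
  apply: (LIle k k N2) => //; first exact: leq_maxr.
  by apply: (hN2 k kN1 n) => //; apply: leq_trans Nn; apply: leq_maxr.
apply: (LIle N1 k N1) => //; first exact: leq_maxl.
apply/(hN1 (maxn k n)); first by rewrite leq_max N1k.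
by apply: LIle Lx; [apply: leq_maxl | apply: leq_maxr].
Qed.

(** * Leading coefficients in R[t; δ] *)

Section LeadingCoefficients.
Variables (R : pzRingType) (δ : derivation R).
Local Notation S := (diffpoly δ).
Implicit Types (p q : S) (I J : S -> Prop).

Definition dp_deg_le (k : nat) p : Prop :=
  forall j, (k < j)%N -> dp_coef j p = 0.

Lemma dp_deg_leW k k' p : (k <= k')%N -> dp_deg_le k p -> dp_deg_le k' p.
Proof. by move=> kk' hp j k'j; apply: hp; apply: leq_ltn_trans k'j. Qed.

Lemma dp_deg_le_mono k a : dp_deg_le k (dp_mono δ k a).
Proof. by move=> j kj; rewrite dp_coef_mono (ltn_eqF kj). Qed.

Lemma dp_deg_le_ex p : exists k, dp_deg_le k p.
Proof.
exists (\max_(i <- dp_supp p) i) => j; apply: contraTeq => pj.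
rewrite -leqNgt; apply: (@leq_bigmax_seq _ _ xpredT id) => //.
by apply: contraNT pj => /dp_coef_out ->.
Qed.

Lemma dp_coef_mul j p q :
  dp_coef j (p * q) =
  \sum_(k <- dp_supp p) dp_coef k p * dp_coef j (iter k (@dp_lmult R δ) q).
Proof.
rewrite [p * q]/(dp_mul p q) /dp_mul raddf_sum.
by apply: eq_bigr => k _ /=; rewrite dp_coef_scale.
Qed.

Lemma dp_deg_le_iter k m q :
  dp_deg_le m q -> dp_deg_le (k + m) (iter k (@dp_lmult R δ) q).
Proof.
move=> hq; elim: k => //= k IH [//|j]; rewrite addSn ltnS => kmj.
by rewrite dp_coef_lmult !IH ?raddf0 ?addr0 // ltnW.
Qed.

(** The δ-part of multiplication by t stays in the same degree, where an
    element of smaller degree has coefficient zero. *)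
Lemma dp_coef_lead_iter k m q : dp_deg_le m q ->
  dp_coef (k + m) (iter k (@dp_lmult R δ) q) = dp_coef m q.
Proof.
move=> hq; elim: k => //= k IH.
rewrite addSn dp_coef_lmult IH (dp_deg_le_iter hq) ?raddf0 ?addr0 //.
Qed.

Lemma dp_deg_leM k m p q :
  dp_deg_le k p -> dp_deg_le m q -> dp_deg_le (k + m) (p * q).
Proof.
move=> hp hq j kmj; rewrite dp_coef_mul big1 // => i _.
have [ik|ki] := leqP i k; last by rewrite hp ?mul0r.
rewrite (dp_deg_le_iter hq) ?mulr0 //.
by apply: leq_ltn_trans kmj; rewrite leq_add2r.
Qed.

Lemma dp_coef_lead_mul k m p q : dp_deg_le k p -> dp_deg_le m q ->
  dp_coef (k + m) (p * q) = dp_coef k p * dp_coef m q.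
Proof.
move=> hp hq; rewrite dp_coef_mul -(dp_coef_lead_iter k hq).
pose F i := dp_coef i p * dp_coef (k + m) (iter i (@dp_lmult R δ) q).
have F0 i : i != k -> F i = 0.
  rewrite /F neq_ltn => /orP[ik|ki]; last by rewrite hp ?mul0r.
  by rewrite (dp_deg_le_iter hq) ?mulr0 // ltn_add2r.
have [kp|kp] := boolP (k \in dp_supp p).
  rewrite (big_fsetD1 k) //= -/(F k) big1_fset ?addr0 // => i.
  by rewrite in_fsetD1 => /andP[/F0].
rewrite (dp_coef_out kp) mul0r big1_fset // => i ip _.
by apply: F0; apply: contraNneq kp => <-.
Qed.

Definition lead_coefs (k : nat) I (a : R) : Prop :=
  exists p, [/\ I p, dp_deg_le k p & dp_coef k p = a].

Lemma lead_coefs_mono k I J :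
  (forall p, I p -> J p) -> forall a, lead_coefs k I a -> lead_coefs k J a.
Proof. by move=> IJ a [p [/IJ Jp hp pa]]; exists p. Qed.

Lemma lead_coefs0 k I : I 0 -> lead_coefs k I 0.
Proof. by move=> I0; exists 0; split=> // [j _|]; rewrite raddf0. Qed.

Lemma lead_coefsB k I : (forall p q, I p -> I q -> I (p - q)) ->
  forall a b, lead_coefs k I a -> lead_coefs k I b -> lead_coefs k I (a - b).
Proof.
move=> IB _ _ [p [Ip hp <-]] [q [Iq hq <-]].
exists (p - q); split; [exact: IB | | exact: dp_coefB].
by move=> j kj; rewrite dp_coefB hp // hq // subrr.
Qed.

(** Multiplication by t^m is the case b = 1, multiplication by a constant the
    case m = 0. *)
Lemma lead_coefsMl k m I b : (forall q p, I p -> I (q * p)) ->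
  forall a, lead_coefs k I a -> lead_coefs (m + k) I (b * a).
Proof.
move=> IM _ [p [Ip hp <-]]; have hb := @dp_deg_le_mono m b.
exists (dp_mono δ m b * p); split; [exact: IM | exact: dp_deg_leM |].
by rewrite dp_coef_lead_mul // dp_coef_mono eqxx.
Qed.

Lemma lead_coefsMr k m I b : (forall p q, I p -> I (p * q)) ->
  forall a, lead_coefs k I a -> lead_coefs (k + m) I (a * b).
Proof.
move=> IM _ [p [Ip hp <-]]; have hb := @dp_deg_le_mono m b.
exists (p * dp_mono δ m b); split; [exact: IM | exact: dp_deg_leM |].
by rewrite dp_coef_lead_mul // dp_coef_mono eqxx.
Qed.

Lemma left_ideal_lead_coefs k I : left_ideal I -> left_ideal (lead_coefs k I).
Proof.
case=> I0 IB IM; split; [exact: lead_coefs0 | exact: lead_coefsB |].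
by move=> b; apply: (lead_coefsMl 0).
Qed.

Lemma right_ideal_lead_coefs k I :
  right_ideal I -> right_ideal (lead_coefs k I).
Proof.
case=> I0 IB IM; split; [exact: lead_coefs0 | exact: lead_coefsB |].
by move=> a b; rewrite -{2}[k]addn0; apply: lead_coefsMr.
Qed.

Lemma left_ideal_lead_coefsS k I :
  left_ideal I -> forall a, lead_coefs k I a -> lead_coefs k.+1 I a.
Proof.
case=> _ _ IM a; rewrite -{2}[a]mul1r; exact: (lead_coefsMl 1).
Qed.

Lemma right_ideal_lead_coefsS k I :
  right_ideal I -> forall a, lead_coefs k I a -> lead_coefs k.+1 I a.
Proof.
case=> _ _ IM a; rewrite -{2}[a]mulr1 -addn1; exact: lead_coefsMr.
Qed.

(** Induction on the degree: an element of J differs from an element of I with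
    the same leading coefficient by an element of J of smaller degree. *)
Lemma lead_coefs_detect I J :
  I 0 -> (forall p q, I p -> I q -> I (p - q)) ->
  (forall p q, J p -> J q -> J (p - q)) -> (forall p, I p -> J p) ->
  (forall k a, lead_coefs k J a -> lead_coefs k I a) -> forall p, J p -> I p.
Proof.
move=> I0 IB JB IJ detL.
have ID p q : I p -> I q -> I (p + q).
  by move=> Ip Iq; rewrite -[q]opprK -[- q]sub0r; do 2?apply: (IB) => //.
have reduce k p : J p -> dp_deg_le k p ->
    exists2 q, I q & forall j, (k <= j)%N -> dp_coef j (p - q) = 0.
  move=> Jp hp; have [|q [Iq hq pq]] := detL k (dp_coef k p); first by exists p.
  exists q => // j; rewrite leq_eqVlt dp_coefB => /predU1P[<-|kj].
    by rewrite pq subrr.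
  by rewrite hp // hq // subrr.
move=> p Jp; have [k] := dp_deg_le_ex p.
elim: k p Jp => [|k IH] p Jp /(reduce _ _ Jp)[q Iq pq0].
all: rewrite -[p](subrK q); apply: ID => //.
  by rewrite (_ : p - q = 0) //; apply: dp_ext => j; rewrite pq0 ?raddf0.
by apply: IH => //; apply: JB => //; apply: IJ.
Qed.

End LeadingCoefficients.

(** * Leading coefficients of graded ideals *)

Section Graded.
Variables (Γ : groupType) (R : pzRingType) (A : grading Γ R) (γ : Γ).
Variable δ : derivation R.

Let A0 := is_grading0 (gradingP A).

Lemma decomposition_uniq x c e :
  decomposition A x c -> decomposition A x e -> c = e.
Proof.
have [f [_ uf]] := is_grading_direct (gradingP A) x.
by move=> /uf <- /uf <-.
Qed.

Lemma dp_deg_le_component k p (c : {malg (diffpoly δ)[Γ]}) τ :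
  decomposition (diffpoly_comp A γ (δ := δ)) p c ->
  dp_deg_le k p -> dp_deg_le k c@_τ.
Proof.
move=> hc hp j kj; have [e he <-] := diffpoly_decomposition_coef j hc.
rewrite (hp j kj) in he.
by rewrite (decomposition_uniq he (decomposition0 A0)) mcoeff0.
Qed.

Lemma graded_lead_coefs k (I : diffpoly δ -> Prop) :
  graded_subset (diffpoly_comp A γ (δ := δ)) I ->
  graded_subset A (lead_coefs k I).
Proof.
move=> grI _ c [p [Ip hp <-]] hc σ.
have [d hd] := diffpoly_decomposition_ex A γ p.
have [e he eE] := diffpoly_decomposition_coef k hd.
(* the component of degree σ of the coefficient of t^k comes from the component
   of p of degree σ γ^k *)
exists d@_(σ * γ ^+ k)%g; split; first exact: grI hd _.
  exact: dp_deg_le_component hd hp.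
by rewrite -eE mulgK (decomposition_uniq hc he).
Qed.

End Graded.

Theorem theorem1p7 (Γ : groupType) (R : pzRingType) (A : grading Γ R) (γ : Γ)
    (hγ : centralizes_support A γ) (δ : derivation R)
    (hδ : der_degree A γ δ) :
  (gr_right_noetherian A -> gr_right_noetherian (diffpoly_grading hγ hδ)) /\
  (gr_left_noetherian A -> gr_left_noetherian (diffpoly_grading hγ hδ)).
Proof.
split; apply: (acc_transfer (L := @lead_coefs R δ)).
- move=> k I [idI /graded_lead_coefs grI]; split=> //.
  exact: right_ideal_lead_coefs.
- exact: lead_coefs_mono.
- by move=> k I [idI _]; apply: right_ideal_lead_coefsS.
- by move=> I J [[I0 IB _] _] [[_ JB _] _]; apply: lead_coefs_detect.
- move=> k I [idI /graded_lead_coefs grI]; split=> //.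
  exact: left_ideal_lead_coefs.
- exact: lead_coefs_mono.
- by move=> k I [idI _]; apply: left_ideal_lead_coefsS.
- by move=> I J [[I0 IB _] _] [[_ JB _] _]; apply: lead_coefs_detect.
Qed.
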